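(* Let $\alpha\ge 0$, $\widetilde{\Gamma}=\widetilde{\Omega}+\alpha\cdot\mathbf{I}$, and let $\{X^{(k)}\}_{k\ge0}$ be a sequence of iterates generated by either $\mathsf{GPM\text{-}PGO}$ or $\mathsf{GPM\text{-}PGO^*}$ (defined in the context). Then: (a) $F(X^{(k)})$ is non-increasing in $k$; (b) there is $F^\infty\in\mathbb{R}$ such that $F(X^{(k)})\to F^\infty$ as $k\to\infty$; (c) $\|X^{(k+1)}-X^{(k)}\|\to 0$ as $k\to\infty$ if $\widetilde{\Gamma}\succ\widetilde{M}$; (d) $\mathrm{grad}\,F(X^{(k)})\to\mathbf{0}$ as $k\to\infty$ if $\widetilde{\Gamma}\succ\widetilde{M}$; (e) $\|X^{(k+1)}-X^{(k)}\|\to 0$ as $k\to\infty$ if $\alpha>0$; (f) $\mathrm{grad}\,F(X^{(k)})\to\mathbf{0}$ as $k\to\infty$ if $\alpha>0$.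
   Context: **Pose graph optimization (PGO) data.** Integers $d\ge 1$, $n\ge 2$; a weakly connected directed graph with vertex set $\mathcal{V}=\{1,\dots,n\}$ and edge set $\overrightarrow{\mathcal{E}}\subset\mathcal{V}\times\mathcal{V}$ (no self-loops); for each $(i,j)\in\overrightarrow{\mathcal{E}}$, a measurement $\widetilde{R}_{ij}\in SO(d)$, $\tilde{t}_{ij}\in\mathbb{R}^d$ and weights $\kappa_{ij}\ge 0$, $\tau_{ij}>0$. Variables are written as $X=\begin{bmatrix} t&R\end{bmatrix}=\begin{bmatrix} t_1&\cdots&t_n&R_1&\cdots&R_n\end{bmatrix}\in\mathbb{R}^{d\times(d+1)n}$ with $t_i\in\mathbb{R}^d$, $R_i\in\mathbb{R}^{d\times d}$; $\mathbb{R}^{d\times n}\times SO(d)^n$ is the submanifold of $\mathbb{R}^{d\times(d+1)n}$ of those $X$ with all $R_i\in SO(d)$. $\|\cdot\|$ is the Frobenius norm. The PGO objective is $$F(X)=\sum_{(i,j)\in\overrightarrow{\mathcal{E}}}\tfrac12\Big(\kappa_{ij}\|R_i\widetilde{R}_{ij}-R_j\|^2+\tau_{ij}\|R_i\tilde{t}_{ij}+t_i-t_j\|^2\Big)=\tfrac12\,\mathrm{trace}(X\widetilde{M}X^\top),$$ where $\widetilde{M}\in\mathbb{R}^{(d+1)n\times(d+1)n}$ is the unique symmetric (positive semidefinite) matrix for which this identity holds for all $X\in\mathbb{R}^{d\times(d+1)n}$; write $\widetilde{M}=\begin{bmatrix} L&\widetilde{V}\\ \widetilde{V}^\top& *\end{bmatrix}$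 with $L\in\mathbb{R}^{n\times n}$, $\widetilde{V}\in\mathbb{R}^{n\times dn}$. The Euclidean gradient is $\nabla F(X)=X\widetilde{M}$. $\mathrm{grad}\,F(X)$ is the Riemannian gradient of $F$ on $\mathbb{R}^{d\times n}\times SO(d)^n$ (embedded submanifold with the Frobenius inner product), i.e. the orthogonal projection of $\nabla F(X)$ onto the tangent space at $X$. $A\succeq B$ (resp. $A\succ B$) means $A-B$ is symmetric positive semidefinite (resp. definite). **Matrices.** $\widetilde{\Omega}$ is the symmetric matrix with $\tfrac12\mathrm{trace}(X\widetilde{\Omega}X^\top)=\sum_{(i,j)\in\overrightarrow{\mathcal{E}}}\big(\kappa_{ij}(\|R_i\|^2+\|R_j\|^2)+\tau_{ij}(\|R_i\tilde{t}_{ij}+t_i\|^2+\|t_j\|^2)\big)$ for all $X\in\mathbb{R}^{d\times(d+1)n}$. With $\alpha\ge0$ and $\widetilde{\Gamma}=\widetilde{\Omega}+\alpha\mathbf{I}$ one has the block form $\widetilde{\Gamma}=\begin{bmatrix}\Gamma^\tau&(\widetilde{\Gamma}^\nu)^\top\\ \widetilde{\Gamma}^\nu&\widetilde{\Gamma}^\rho\end{bmatrix}$ with $\Gamma^\tau=\mathrm{diag}\{\Gamma^\tau_i\}$, $\widetilde{\Gamma}^\nu=\mathrm{diag}\{\widetilde{\Gamma}^\nu_i\}$, $\widetilde{\Gamma}^\rho=\mathrm{diag}\{\widetilde{\Gamma}^\rho_i\}$ (block diagonal), $$\Gamma_i^\tau=\alpha+\sum_{e\ni i}2\tau_e\in\mathbb{R},\quad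 \widetilde{\Gamma}_i^\rho=\alpha\mathbf{I}+\sum_{e\ni i}2\kappa_e\mathbf{I}+\sum_{j:(i,j)\in\overrightarrow{\mathcal{E}}}2\tau_{ij}\tilde{t}_{ij}\tilde{t}_{ij}^\top\in\mathbb{R}^{d\times d},\quad \widetilde{\Gamma}_i^\nu=\sum_{j:(i,j)\in\overrightarrow{\mathcal{E}}}2\tau_{ij}\tilde{t}_{ij}\in\mathbb{R}^d,$$ where $\sum_{e\ni i}$ runs over edges of $\overrightarrow{\mathcal{E}}$ having $i$ as an endpoint (either orientation). **Method $\mathsf{GPM\text{-}PGO}$.** Start from any $X^{(0)}\in\mathbb{R}^{d\times n}\times SO(d)^n$. Given $X^{(k)}=\begin{bmatrix}t^{(k)}&R^{(k)}\end{bmatrix}$, write $\nabla F(X^{(k)})=\begin{bmatrix}\overline{\gamma}^\tau_1&\cdots&\overline{\gamma}^\tau_n&\overline{\gamma}^\rho_1&\cdots&\overline{\gamma}^\rho_n\end{bmatrix}$ ($\overline{\gamma}^\tau_i\in\mathbb{R}^d$, $\overline{\gamma}^\rho_i\in\mathbb{R}^{d\times d}$) and for each $i$ set $$\theta_i^{(k)}=R_i^{(k)}\big(\widetilde{\Gamma}_i^\rho-\widetilde{\Gamma}_i^\nu(\Gamma_i^\tau)^{-1}(\widetilde{\Gamma}_i^\nu)^\top\big)+\overline{\gamma}_i^\tau(\Gamma_i^\tau)^{-1}(\widetilde{\Gamma}_i^\nu)^\top-\overline{\gamma}_i^\rho,$$ $$R_i^{(k+1)}\in\arg\max_{R_i\in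 SO(d)}\mathrm{trace}(R_i^\top\theta_i^{(k)}),\qquad t_i^{(k+1)}=t_i^{(k)}-R_i^{(k+1)}\widetilde{\Gamma}_i^\nu(\Gamma_i^\tau)^{-1}+\big(R_i^{(k)}\widetilde{\Gamma}_i^\nu-\overline{\gamma}_i^\tau\big)(\Gamma_i^\tau)^{-1}.$$ (Equivalently, $X^{(k+1)}$ is a minimizer over $\mathbb{R}^{d\times n}\times SO(d)^n$ of $F(X^{(k)})+\mathrm{trace}((X-X^{(k)})^\top\nabla F(X^{(k)}))+\frac12\mathrm{trace}((X-X^{(k)})\widetilde{\Gamma}(X-X^{(k)})^\top)$.) **Method $\mathsf{GPM\text{-}PGO^*}$.** Start from $X^{(0)}=\begin{bmatrix}t^{(0)}&R^{(0)}\end{bmatrix}$ with $R^{(0)}\in SO(d)^n$ and $t^{(0)}=-R^{(0)}\widetilde{V}^\top L^\dagger$ ($\dagger$ = Moore–Penrose pseudoinverse; this $t^{(0)}$ minimizes $F$ over $t$ for fixed $R^{(0)}$). Given $X^{(k)}=\begin{bmatrix}t^{(k)}&R^{(k)}\end{bmatrix}$, write $\nabla F(X^{(k)})=X^{(k)}\widetilde{M}=\begin{bmatrix}\overline{\gamma}^\tau_1&\cdots&\overline{\gamma}^\tau_n&\overline{\gamma}^\rho_1&\cdots&\overline{\gamma}^\rho_n\end{bmatrix}$ with $\overline{\gamma}^\tau_i\in\mathbb{R}^d$ and $\overline{\gamma}^\rho_i\in\mathbb{R}^{d\times d}$ (so $\overline{\gamma}^\rho_i$ is the Euclidean gradient of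 $F$ with respect to $R_i$ at $X^{(k)}$), and set $$\theta_i^{(k)}=R_i^{(k)}\big(\widetilde{\Gamma}_i^\rho-\widetilde{\Gamma}_i^\nu(\Gamma_i^\tau)^{-1}(\widetilde{\Gamma}_i^\nu)^\top\big)-\overline{\gamma}_i^\rho,\quad R_i^{(k+1)}\in\arg\max_{R_i\in SO(d)}\mathrm{trace}(R_i^\top\theta_i^{(k)}),\quad t^{(k+1)}=-R^{(k+1)}\widetilde{V}^\top L^\dagger.$$ In both methods the iteration is run indefinitely, and any maximizer may be chosen when the argmax is not unique. *)

(* Defs.v *)
From HB Require Import structures.
From mathcomp Require Import all_boot all_order all_algebra.
From mathcomp Require Import all_classical all_reals all_analysis.
From mathcomp Require Import ring lra.
Set Implicit Arguments.
Unset Strict Implicit.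
Unset Printing Implicit Defensive.
Import Order.TTheory GRing.Theory Num.Theory.
Import numFieldNormedType.Exports.
Local Open Scope classical_set_scope.
Local Open Scope ring_scope.

(** * Matrices *)

(* [mxdot] and [frob] are the Frobenius inner product and norm; the library's
   norm on matrices is the max norm (it induces the same topology). *)
Definition mxdot (R : realType) (m p : nat) (A B : 'M[R]_(m, p)) : R :=
  \tr (A *m B^T).

Definition frob (R : realType) (m p : nat) (A : 'M[R]_(m, p)) : R :=
  Num.sqrt (mxdot A A).

Definition posdefmx (R : realType) (p : nat) (A : 'M[R]_p) : Prop :=
  A^T = A /\ forall x : 'cV[R]_p, x != 0 -> 0 < \tr (x^T *m A *m x).

Definition penrose (R : realType) (m p : nat)
    (A : 'M[R]_(m, p)) (B : 'M[R]_(p, m)) : Prop :=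
  [/\ A *m B *m A = A, B *m A *m B = B,
      (A *m B)^T = A *m B & (B *m A)^T = B *m A].

(* The Moore-Penrose pseudoinverse; see [mp_pinvP] and [penrose_uniq]. *)
Definition mp_pinv (R : realType) (m p : nat) (A : 'M[R]_(m, p)) : 'M[R]_(p, m) :=
  xget 0 [set B | penrose A B].

Definition is_quad_mx (R : realType) (d N : nat)
    (Q : 'M[R]_(d, N) -> R) (M : 'M[R]_N) : Prop :=
  M^T = M /\ forall X, Q X = 2^-1 * \tr (X *m M *m X^T).

(* The symmetric matrix representing Q, which is unique when 0 < d
   ([is_quad_mx_uniq]); it exists for the two functions it is used for below
   ([MtP] and [OmegaP]). *)
Definition quad_mx (R : realType) (d N : nat) (Q : 'M[R]_(d, N) -> R) : 'M[R]_N :=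
  xget 0 [set M | is_quad_mx Q M].

Definition SO (R : realType) (d : nat) : set 'M[R]_d :=
  [set Q | Q^T *m Q = 1%:M /\ \det Q = 1].

Definition argmax_SO (R : realType) (d : nat) (theta Q : 'M[R]_d) : Prop :=
  SO Q /\ forall P, SO P -> \tr (P^T *m theta) <= \tr (Q^T *m theta).

(** * Pose graph data *)

(* The values of mrot, mtra, kap and tau off the edge set are irrelevant. *)
Record pgo_data (R : realType) (d n : nat) := PGOData {
  edges : {set 'I_n * 'I_n};
  edges_noloop : forall e, e \in edges -> e.1 != e.2;
  edges_connected : forall i j,
    connect (fun u v => ((u, v) \in edges) || ((v, u) \in edges)) i j;
  mrot : 'I_n * 'I_n -> 'M[R]_d;
  mtra : 'I_n * 'I_n -> 'cV[R]_d;
  kap : 'I_n * 'I_n -> R;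
  tau : 'I_n * 'I_n -> R;
  mrot_SO : forall e, e \in edges -> SO (mrot e);
  kap_ge0 : forall e, e \in edges -> 0 <= kap e;
  tau_gt0 : forall e, e \in edges -> 0 < tau e
}.

(* X = [t_1 ... t_n R_1 ... R_n]; the number of columns is
   n + (d + ... + d) = (d + 1) n. *)
Notation pose_dim d n := (n + \sum_(i < n) d)%N.

Definition tblk (R : realType) (d n : nat) (X : 'M[R]_(d, pose_dim d n))
    (i : 'I_n) : 'cV[R]_d :=
  col i (lsubmx X).

Definition Rblk (R : realType) (d n : nat) (X : 'M[R]_(d, pose_dim d n))
    (i : 'I_n) : 'M[R]_d :=
  submxrow (q_ := fun _ : 'I_n => d) (rsubmx X) i.

(* R^{d x n} x SO(d)^n *)
Definition pose_mfd (R : realType) (d n : nat) : set 'M[R]_(d, pose_dim d n) :=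
  [set X | forall i, SO (Rblk X i)].

(* Velocities at 0 of the curves on R^{d x n} x SO(d)^n that pass through X at
   time 0 and are differentiable there; see [tangentE] for the explicit
   description. *)
Definition tangent (R : realType) (d n : nat) (X : 'M[R]_(d, pose_dim d n)) :
    set 'M[R]_(d, pose_dim d n) :=
  [set V | exists c : R -> 'M[R]_(d, pose_dim d n),
    [/\ forall s, pose_mfd (c s), c 0 = X & is_derive (0 : R) (1 : R) c V]].

Section Objective.
Context (R : realType) (d n : nat) (G : pgo_data R d n).
Implicit Type X : 'M[R]_(d, pose_dim d n).

Definition pgoF X : R :=
  \sum_(e in edges G) 2^-1 *
    (kap G e * frob (Rblk X e.1 *m mrot G e - Rblk X e.2) ^+ 2
     + tau G e * frob (Rblk X e.1 *m mtra G e + tblk X e.1 - tblk X e.2) ^+ 2).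

Definition omegaQ X : R :=
  \sum_(e in edges G)
    (kap G e * (frob (Rblk X e.1) ^+ 2 + frob (Rblk X e.2) ^+ 2)
     + tau G e * (frob (Rblk X e.1 *m mtra G e + tblk X e.1) ^+ 2
                  + frob (tblk X e.2) ^+ 2)).

Definition Mt : 'M[R]_(pose_dim d n) := quad_mx pgoF.

Definition Lmx : 'M[R]_n := ulsubmx Mt.

Definition Vmx : 'M[R]_(n, \sum_(i < n) d) := ursubmx Mt.

(* The Euclidean gradient of F; see [egradP]. *)
Definition egrad X : 'M[R]_(d, pose_dim d n) := X *m Mt.

Definition is_rgrad X P : Prop :=
  tangent X P /\ forall V, tangent X V -> mxdot (egrad X - P) V = 0.

(* The Riemannian gradient: the orthogonal projection of [egrad X] onto
   [tangent X]; see [rgradP]. *)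
Definition rgrad X : 'M[R]_(d, pose_dim d n) := xget 0 [set P | is_rgrad X P].

Definition Omega : 'M[R]_(pose_dim d n) := quad_mx omegaQ.

Context (alpha : R).

Definition Gamma : 'M[R]_(pose_dim d n) := Omega + alpha%:M.

(* The diagonal blocks of the blocks of [Gamma]; see [Gamma_blk]. *)
Definition Gtau (i : 'I_n) : R :=
  alpha + \sum_(e in edges G | (e.1 == i) || (e.2 == i)) 2 * tau G e.

Definition Gnu (i : 'I_n) : 'cV[R]_d :=
  \sum_(e in edges G | e.1 == i) (2 * tau G e) *: mtra G e.

Definition Grho (i : 'I_n) : 'M[R]_d :=
  alpha%:M
  + (\sum_(e in edges G | (e.1 == i) || (e.2 == i)) 2 * kap G e)%:M
  + \sum_(e in edges G | e.1 == i) (2 * tau G e) *: (mtra G e *m (mtra G e)^T).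

Definition theta_gpm X (i : 'I_n) : 'M[R]_d :=
  Rblk X i *m (Grho i - (Gtau i)^-1 *: (Gnu i *m (Gnu i)^T))
  + (Gtau i)^-1 *: (tblk (egrad X) i *m (Gnu i)^T)
  - Rblk (egrad X) i.

Definition theta_gpm_star X (i : 'I_n) : 'M[R]_d :=
  Rblk X i *m (Grho i - (Gtau i)^-1 *: (Gnu i *m (Gnu i)^T))
  - Rblk (egrad X) i.

Definition gpm_step X Y : Prop :=
  forall i,
    argmax_SO (theta_gpm X i) (Rblk Y i) /\
    tblk Y i = tblk X i - (Gtau i)^-1 *: (Rblk Y i *m Gnu i)
               + (Gtau i)^-1 *: (Rblk X i *m Gnu i - tblk (egrad X) i).

(* t = - R V^T L^+ *)
Definition t_opt X : Prop := lsubmx X = - (rsubmx X *m Vmx^T *m mp_pinv Lmx).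

Definition gpm_star_step X Y : Prop :=
  (forall i, argmax_SO (theta_gpm_star X i) (Rblk Y i)) /\ t_opt Y.

(* Sequences of iterates generated by GPM-PGO, resp. GPM-PGO*. *)
Definition gpm_pgo (X : nat -> 'M[R]_(d, pose_dim d n)) : Prop :=
  pose_mfd (X 0%N) /\ forall k, gpm_step (X k) (X k.+1).

Definition gpm_pgo_star (X : nat -> 'M[R]_(d, pose_dim d n)) : Prop :=
  [/\ pose_mfd (X 0%N), t_opt (X 0%N) & forall k, gpm_star_step (X k) (X k.+1)].

End Objective.

Arguments SO {R d}.
Arguments pose_mfd {R d n}.

(** * Existence and uniqueness of the objects above *)

Section MatrixFacts.
Context (R : realType).

Lemma mxdotE m p (A B : 'M[R]_(m, p)) :
  mxdot A B = \sum_i \sum_j A i j * B i j.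
Proof.
by apply: eq_bigr => i _; rewrite mxE; apply: eq_bigr => j _; rewrite mxE.
Qed.

Lemma mxdotC m p (A B : 'M[R]_(m, p)) : mxdot A B = mxdot B A.
Proof. by rewrite /mxdot -mxtrace_tr trmx_mul trmxK. Qed.

Lemma mxdotDl m p (A A' B : 'M[R]_(m, p)) :
  mxdot (A + A') B = mxdot A B + mxdot A' B.
Proof. by rewrite /mxdot mulmxDl mxtraceD. Qed.

Lemma mxdotZl m p a (A B : 'M[R]_(m, p)) : mxdot (a *: A) B = a * mxdot A B.
Proof. by rewrite /mxdot -scalemxAl mxtraceZ. Qed.

Lemma mxdotNl m p (A B : 'M[R]_(m, p)) : mxdot (- A) B = - mxdot A B.
Proof. by rewrite /mxdot mulNmx raddfN. Qed.

Lemma mxdotBl m p (A A' B : 'M[R]_(m, p)) :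
  mxdot (A - A') B = mxdot A B - mxdot A' B.
Proof. by rewrite mxdotDl mxdotNl. Qed.

Lemma mxdot_ge0 m p (A : 'M[R]_(m, p)) : 0 <= mxdot A A.
Proof.
rewrite mxdotE; apply: sumr_ge0 => i _; apply: sumr_ge0 => j _.
by rewrite -expr2 sqr_ge0.
Qed.

Lemma mxdot_eq0 m p (A : 'M[R]_(m, p)) : (mxdot A A == 0) = (A == 0).
Proof.
apply/idP/eqP => [|->]; last by rewrite /mxdot mul0mx mxtrace0.
rewrite mxdotE psumr_eq0 => [/allP h|i _]; last first.
  by apply: sumr_ge0 => j _; rewrite -expr2 sqr_ge0.
apply/matrixP => i j; rewrite mxE.
have := h i (mem_index_enum _); rewrite psumr_eq0 => [/allP h2|k _]; last first.
  by rewrite -expr2 sqr_ge0.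
by have := h2 j (mem_index_enum _); rewrite mulf_eq0 orbb => /eqP.
Qed.

Lemma frob_sqr m p (A : 'M[R]_(m, p)) : frob A ^+ 2 = mxdot A A.
Proof. by rewrite sqr_sqrtr // mxdot_ge0. Qed.

Lemma mulmx_tr_eq0 m p q (A : 'M[R]_(m, p)) (B : 'M[R]_(q, m)) :
  B *m (A *m A^T) = 0 -> B *m A = 0.
Proof.
move=> h; apply/eqP; rewrite -mxdot_eq0 /mxdot trmx_mul mulmxA -(mulmxA B) h.
by rewrite mul0mx mxtrace0.
Qed.

Lemma gram_unit m p (A : 'M[R]_(m, p)) : row_free A -> A *m A^T \in unitmx.
Proof.
move=> fA; rewrite -row_free_unit -kermx_eq0; apply/eqP.
have /mulmx_tr_eq0 h : kermx (A *m A^T) *m (A *m A^T) = 0 by exact: mulmx_ker.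
by apply: (row_free_inj fA); rewrite h mul0mx.
Qed.

Lemma penrose_factor m p r (C : 'M[R]_(m, r)) (D : 'M[R]_(r, p)) :
  row_full C -> row_free D -> exists B, penrose (C *m D) B.
Proof.
move=> fC fD.
have uD : D *m D^T \in unitmx by exact: gram_unit.
have uC : C^T *m C \in unitmx.
  by rewrite -{2}(trmxK C); apply: gram_unit; rewrite /row_free mxrank_tr.
pose iD := invmx (D *m D^T); pose iC := invmx (C^T *m C).
have iDT : iD^T = iD by rewrite /iD trmx_inv trmx_mul trmxK.
have iCT : iC^T = iC by rewrite /iC trmx_inv trmx_mul trmxK.
have DiD : D *m D^T *m iD = 1%:M by exact: mulmxV.
have iCC : iC *m (C^T *m C) = 1%:M by exact: mulVmx.
pose B := D^T *m iD *m iC *m C^T.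
have AB : C *m D *m B = C *m iC *m C^T.
  by rewrite /B !mulmxA -(mulmxA C D) -(mulmxA C (D *m D^T)) DiD mulmx1.
have BA : B *m (C *m D) = D^T *m iD *m D.
  by rewrite /B !mulmxA -(mulmxA _ C^T C) -(mulmxA _ iC) iCC mulmx1.
exists B; split.
- by rewrite AB !mulmxA -(mulmxA _ C^T C) -(mulmxA C iC) iCC mulmx1.
- rewrite BA /B !mulmxA -(mulmxA _ D D^T) -(mulmxA (D^T *m iD) (D *m D^T)).
  by rewrite DiD mulmx1.
- by rewrite AB !trmx_mul trmxK iCT mulmxA.
- by rewrite BA !trmx_mul trmxK iDT mulmxA.
Qed.

Lemma penrose_ex m p (A : 'M[R]_(m, p)) : exists B, penrose A B.
Proof.
have := penrose_factor (col_base_full A) (row_base_free A).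
by rewrite mulmx_base.
Qed.

Lemma mp_pinvP m p (A : 'M[R]_(m, p)) : penrose A (mp_pinv A).
Proof. by apply: xgetPex; exact: penrose_ex. Qed.

Lemma penrose_uniq m p (A : 'M[R]_(m, p)) B B' :
  penrose A B -> penrose A B' -> B = B'.
Proof.
move=> [b1 b2 b3 b4] [c1 c2 c3 c4].
have E1 : A *m B = A *m B'.
  rewrite -[LHS]b3 -{1}c1 -(mulmxA (A *m B')) trmx_mul b3 c3 mulmxA b1.
  by [].
have E2 : B *m A = B' *m A.
  have h : B *m A = (B *m A) *m (B' *m A) by rewrite -mulmxA (mulmxA A) c1.
  by rewrite -[LHS]b4 h trmx_mul b4 c4 -mulmxA (mulmxA A) b1.
by rewrite -b2 E2 -mulmxA E1 mulmxA.
Qed.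

Lemma is_quad_mx_uniq d N (Q : 'M[R]_(d, N) -> R) M M' :
  (0 < d)%N -> is_quad_mx Q M -> is_quad_mx Q M' -> M = M'.
Proof.
case: d Q => // d Q _ [sM qM] [sM' qM'].
have eqt (X : 'M[R]_(d.+1, N)) : \tr (X *m M *m X^T) = \tr (X *m M' *m X^T).
  have h2 : (2^-1 : R) != 0 by rewrite invr_eq0 pnatr_eq0.
  by apply: (mulfI h2); rewrite -qM qM'.
have eqv (x : 'rV[R]_N) : (x *m M *m x^T) 0 0 = (x *m M' *m x^T) 0 0.
  pose u := delta_mx 0 0 : 'cV[R]_d.+1.
  have uu : u^T *m u = 1%:M.
    by rewrite /u trmx_delta mul_delta_mx; apply/matrixP => i j; rewrite !mxE !ord1.
  have tu (A : 'M[R]_N) : \tr (u *m x *m A *m (u *m x)^T) = (x *m A *m x^T) 0 0.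
    rewrite trmx_mul -!mulmxA mxtrace_mulC -!mulmxA uu mulmx1 !mulmxA.
    by rewrite /mxtrace big_ord1.
  by rewrite -!tu.
pose f (A : 'M[R]_N) (x y : 'rV[R]_N) := (x *m A *m y^T) 0 0.
have fC A x y : A^T = A -> f A x y = f A y x.
  move=> sA; rewrite /f -[in LHS](trmxK (x *m A *m y^T)) mxE.
  by rewrite !trmx_mul trmxK sA mulmxA.
have fD A x y : f A (x + y) (x + y) = f A x x + f A x y + (f A y x + f A y y).
  by rewrite /f linearD /= !(mulmxDl, mulmxDr) !mxE; ring.
have key x y : f M x y = f M' x y.
  have := eqv (x + y); rewrite -!/(f _ _ _) !fD.
  rewrite (fC M y x) // (fC M' y x) // /f !eqv; lra.
apply/matrixP => i j.
have fE (A : 'M[R]_N) : f A (delta_mx 0 i) (delta_mx 0 j) = A i j.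
  by rewrite /f -rowE trmx_delta -colE !mxE.
by rewrite -!fE.
Qed.

Lemma is_quad_mxP d N (Q : 'M[R]_(d, N) -> R) :
  (exists M, is_quad_mx Q M) -> is_quad_mx Q (quad_mx Q).
Proof. by move=> h; apply: xgetPex. Qed.

Lemma is_quad_mxD d N (Q Q' : 'M[R]_(d, N) -> R) M M' :
  is_quad_mx Q M -> is_quad_mx Q' M' -> is_quad_mx (fun X => Q X + Q' X) (M + M').
Proof.
move=> [sM qM] [sM' qM']; split=> [|X]; first by rewrite linearD /= sM sM'.
by rewrite qM qM' mulmxDr mulmxDl mxtraceD mulrDr.
Qed.

Lemma is_quad_mxZ d N (Q : 'M[R]_(d, N) -> R) M a :
  is_quad_mx Q M -> is_quad_mx (fun X => a * Q X) (a *: M).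
Proof.
move=> [sM qM]; split=> [|X]; first by rewrite linearZ /= sM.
by rewrite qM -scalemxAr -scalemxAl mxtraceZ mulrCA.
Qed.

Lemma is_quad_mx_frob d N p (f : 'M[R]_(d, N) -> 'M[R]_(d, p)) B :
  (forall X, f X = X *m B) ->
  is_quad_mx (fun X => frob (f X) ^+ 2) (2 *: (B *m B^T)).
Proof.
move=> fE; split=> [|X]; first by rewrite linearZ /= trmx_mul trmxK.
rewrite frob_sqr /mxdot fE trmx_mul -scalemxAr -scalemxAl mxtraceZ !mulmxA.
by rewrite mulrA mulVf ?pnatr_eq0 // mul1r.
Qed.

Lemma is_quad_mx_sum d N (I : finType) (P : pred I) (Q : I -> 'M[R]_(d, N) -> R) :
  (forall i, P i -> exists M, is_quad_mx (Q i) M) ->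
  exists M, is_quad_mx (fun X => \sum_(i | P i) Q i X) M.
Proof.
move=> h.
suff [M hM] : exists M : I -> 'M[R]_N, forall i, P i -> is_quad_mx (Q i) (M i).
  exists (\sum_(i | P i) M i); split=> [|X].
    by rewrite linear_sum /=; apply: eq_bigr => i /hM [].
  rewrite mulmx_sumr mulmx_suml raddf_sum mulr_sumr.
  by apply: eq_bigr => i /hM [_ ->].
exists (fun i => quad_mx (Q i)) => i /h; exact: is_quad_mxP.
Qed.

End MatrixFacts.

Section PoseFacts.
Context (R : realType) (d n : nat).
Implicit Types X Y : 'M[R]_(d, pose_dim d n).

Lemma tblk_mul X i : tblk X i = X *m col i (lsubmx 1%:M).
Proof. by rewrite /tblk !colE mulmxA mulmx_lsub mulmx1. Qed.

Lemma Rblk_mul X i :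
  Rblk X i = X *m submxrow (q_ := fun _ : 'I_n => d) (rsubmx 1%:M) i.
Proof. by rewrite /Rblk mul_submxrow mulmx_rsub mulmx1. Qed.

Lemma RblkB X Y i : Rblk (X - Y) i = Rblk X i - Rblk Y i.
Proof. by apply/matrixP => a b; rewrite !mxE. Qed.

Lemma mxdot_blk X Y :
  mxdot X Y = mxdot (lsubmx X) (lsubmx Y) + \sum_i mxdot (Rblk X i) (Rblk Y i).
Proof.
rewrite -{1}(hsubmxK X) -{1}(hsubmxK Y) /mxdot tr_row_mx mul_row_col mxtraceD.
congr (_ + _).
rewrite -{1}(submxrowK (rsubmx X)) -{1}(submxrowK (rsubmx Y)).
by rewrite tr_mxrow mul_mxrow_mxcol raddf_sum.
Qed.

Variable G : pgo_data R d n.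

Lemma MtP : is_quad_mx (pgoF G) (Mt G).
Proof.
apply: is_quad_mxP; apply: is_quad_mx_sum => e _; eexists.
apply: is_quad_mxZ; apply: is_quad_mxD; apply: is_quad_mxZ;
  apply: is_quad_mx_frob => X.
- by rewrite !Rblk_mul -mulmxA -mulmxBr; reflexivity.
- by rewrite Rblk_mul !tblk_mul -mulmxA -mulmxDr -mulmxBr; reflexivity.
Qed.

Lemma OmegaP : is_quad_mx (omegaQ G) (Omega G).
Proof.
apply: is_quad_mxP; apply: is_quad_mx_sum => e _; eexists.
apply: is_quad_mxD; apply: is_quad_mxZ; apply: is_quad_mxD;
  apply: is_quad_mx_frob => X.
- by rewrite Rblk_mul; reflexivity.
- by rewrite Rblk_mul; reflexivity.
- by rewrite Rblk_mul tblk_mul -mulmxA -mulmxDr; reflexivity.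
- by rewrite tblk_mul; reflexivity.
Qed.

Lemma sum_incident (a : 'I_n * 'I_n -> R) (f : 'I_n -> R) :
  \sum_i (\sum_(e in edges G | (e.1 == i) || (e.2 == i)) a e) * f i
  = \sum_(e in edges G) a e * (f e.1 + f e.2).
Proof.
under eq_bigr do rewrite mulr_suml.
rewrite (exchange_big_dep (mem (edges G))) /=; last by move=> i e _ /andP[].
apply: eq_bigr => e eE.
have e12 := edges_noloop eE.
rewrite (bigD1 e.1) /=; last by rewrite eE eqxx.
rewrite (bigD1 e.2) /=; last by rewrite eE eqxx orbT eq_sym.
rewrite big1 ?addr0 ?mulrDr // => i /andP[/andP[/andP[_ h]]] h1 h2.
by move: h; rewrite eq_sym (negPf h1) eq_sym (negPf h2).
Qed.

Lemma sum_tail (a : 'I_n * 'I_n -> 'I_n -> R) :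
  \sum_i \sum_(e in edges G | e.1 == i) a e i
  = \sum_(e in edges G) a e e.1.
Proof.
rewrite (exchange_big_dep (mem (edges G))) /=; last by move=> i e _ /andP[].
apply: eq_bigr => e eE.
rewrite (bigD1 e.1) /=; last by rewrite eE eqxx.
rewrite big1 ?addr0 // => i /andP[/andP[_ /eqP ->]].
by rewrite eqxx.
Qed.

Lemma Gamma_blk alpha X :
  \tr (X *m Gamma G alpha *m X^T) =
  \sum_i (Gtau G alpha i * frob (tblk X i) ^+ 2
          + 2 * mxdot (Rblk X i *m Gnu G i) (tblk X i)
          + mxdot (Rblk X i *m Grho G alpha i) (Rblk X i)).
Proof.
have [_ qO] := OmegaP.
rewrite /Gamma mulmxDr mulmxDl mxtraceD mul_mx_scalar -scalemxAl mxtraceZ.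
have -> : \tr (X *m Omega G *m X^T) = 2 * omegaQ G X.
  by rewrite qO mulrA mulfV ?pnatr_eq0 // mul1r.
rewrite -/(mxdot X X) mxdot_blk.
have -> : mxdot (lsubmx X) (lsubmx X) = \sum_i mxdot (tblk X i) (tblk X i).
  rewrite mxdotE exchange_big; apply: eq_bigr => i _.
  by rewrite mxdotE; apply: eq_bigr => a _; rewrite big_ord1 !mxE.
pose T i := mxdot (tblk X i) (tblk X i).
pose S i := mxdot (Rblk X i) (Rblk X i).
pose a e := mxdot (Rblk X e.1 *m mtra G e) (tblk X e.1).
pose b e := mxdot (Rblk X e.1 *m mtra G e) (Rblk X e.1 *m mtra G e).
have -> : \sum_i (Gtau G alpha i * frob (tblk X i) ^+ 2
      + 2 * mxdot (Rblk X i *m Gnu G i) (tblk X i)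
      + mxdot (Rblk X i *m Grho G alpha i) (Rblk X i))
  = \sum_i (alpha * T i + alpha * S i)
    + \sum_i (\sum_(e in edges G | (e.1 == i) || (e.2 == i)) 2 * tau G e) * T i
    + \sum_i (\sum_(e in edges G | (e.1 == i) || (e.2 == i)) 2 * kap G e) * S i
    + \sum_i \sum_(e in edges G | e.1 == i) (2 * tau G e) *
        (2 * mxdot (Rblk X i *m mtra G e) (tblk X i)
         + mxdot (Rblk X i *m mtra G e) (Rblk X i *m mtra G e)).
  rewrite -!big_split /=; apply: eq_bigr => i _.
  rewrite frob_sqr -/(T i) /Gtau /Grho /Gnu.
  rewrite !mulmxDr !mxdotDl !mul_mx_scalar !mxdotZl -/(S i).
  have -> : mxdot (Rblk X i *m
        (\sum_(e in edges G | e.1 == i) (2 * tau G e) *: mtra G e)) (tblk X i)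
      = \sum_(e in edges G | e.1 == i) (2 * tau G e) *
          mxdot (Rblk X i *m mtra G e) (tblk X i).
    rewrite /mxdot mulmx_sumr mulmx_suml raddf_sum; apply: eq_bigr => e _.
    by rewrite -scalemxAr -scalemxAl /= mxtraceZ.
  have -> : mxdot (Rblk X i *m (\sum_(e in edges G | e.1 == i)
        (2 * tau G e) *: (mtra G e *m (mtra G e)^T))) (Rblk X i)
      = \sum_(e in edges G | e.1 == i) (2 * tau G e) *
          mxdot (Rblk X i *m mtra G e) (Rblk X i *m mtra G e).
    rewrite /mxdot mulmx_sumr mulmx_suml raddf_sum; apply: eq_bigr => e _.
    by rewrite -scalemxAr -scalemxAl /= mxtraceZ trmx_mul !mulmxA.
  rewrite [in RHS](eq_bigr _ (fun e _ => mulrDr (2 * tau G e) _ _)) big_split /=.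
  have -> : \sum_(e in edges G | e.1 == i) 2 * tau G e *
        (2 * mxdot (Rblk X i *m mtra G e) (tblk X i))
      = 2 * \sum_(e in edges G | e.1 == i) 2 * tau G e *
          mxdot (Rblk X i *m mtra G e) (tblk X i).
    by rewrite mulr_sumr; apply: eq_bigr => e _; rewrite mulrCA.
  ring.
rewrite !sum_incident sum_tail big_split /= -!mulr_sumr.
rewrite -/T -/S.
have -> : omegaQ G X = \sum_(e in edges G) (kap G e * (S e.1 + S e.2)
    + tau G e * (b e + 2 * a e + T e.1 + T e.2)).
  apply: eq_bigr => e _; rewrite !frob_sqr -/(S _) -/(T _); congr (_ + _ * (_ + _)).
  rewrite mxdotDl !(mxdotC _ (_ + _)) !mxdotDl -/(b e) -/(T _) -/(a e).
  by rewrite (mxdotC (tblk X e.1)) -/(a e); ring.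
rewrite mulr_sumr -!mulrDr -!addrA addrC -!big_split /=; congr (_ + _).
by apply: eq_bigr => e _; rewrite -/(a e) -/(b e); ring.
Qed.

Lemma pgoFD X Y :
  pgoF G (X + Y) = pgoF G X + mxdot (egrad G X) Y + pgoF G Y.
Proof.
have [sM qM] := MtP; rewrite !qM /mxdot /egrad linearD /=.
rewrite !(mulmxDl, mulmxDr) !mxtraceD.
have -> : \tr (Y *m Mt G *m X^T) = \tr (X *m Mt G *m Y^T).
  by rewrite -mxtrace_tr !trmx_mul trmxK sM mulmxA.
lra.
Qed.

Lemma pgoFZ a X : pgoF G (a *: X) = a ^+ 2 * pgoF G X.
Proof.
have [_ qM] := MtP; rewrite !qM linearZ /= -!scalemxAl -scalemxAr !mxtraceZ.
ring.
Qed.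

Lemma egradP X (V : 'M[R]_(d, pose_dim d n)) : is_derive X V (pgoF G) (mxdot (egrad G X) V).
Proof.
have h : h^-1 *: (pgoF G (h *: V + X) - pgoF G X) @[h --> (0 : R)^'] -->
    mxdot (egrad G X) V.
  have id0 : h @[h --> (0 : R)^'] --> (0 : R) by move=> A; exact: nbhs_dnbhs.
  have : mxdot (egrad G X) V + h * pgoF G V @[h --> (0 : R)^'] -->
      mxdot (egrad G X) V.
    rewrite -[X in _ --> X]addr0; apply: cvgD; first exact: cvg_cst.
    by rewrite -[X in _ --> X](mul0r (pgoF G V)); exact: cvgM id0 (cvg_cst _).
  apply: cvg_trans; apply: near_eq_cvg; near=> h.
  have h0 : h != 0 by near: h; exact: nbhs_dnbhs_neq.
  rewrite (_ : h *: V + X = X + h *: V); last by rewrite addrC.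
  rewrite pgoFD pgoFZ. rewrite (mxdotC _ (_ *: _)). rewrite mxdotZl mxdotC.
  rewrite /GRing.scale /=.
  by field.
by apply: DeriveDef; [apply/cvg_ex; eexists; exact: h|exact: cvg_lim h].
Unshelve. all: by end_near. Qed.

Lemma is_derive_mxP m p (c : R -> 'M[R]_(m, p)) (x v : R) V :
  is_derive x v c V <-> forall i j, is_derive x v (fun s => c s i j) (V i j).
Proof.
split=> [[dc <-] i j|h].
  split; first exact: (iffLR (derivable_mxP _ _ _) dc).
  by rewrite derive_mx // mxE.
have dc : derivable c x v by apply/derivable_mxP => i j; case: (h i j).
split=> //; apply/matrixP => i j; rewrite derive_mx // mxE.
exact: derive_val.
Qed.

Lemma skew_unit (S : 'M[R]_d) x : S^T = - S -> 1%:M - x *: S \in unitmx.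
Proof.
move=> sS; rewrite -row_free_unit -kermx_eq0 -mxdot_eq0; apply/eqP.
set K := kermx _.
have KS : K = x *: (K *m S).
  have : K *m (1%:M - x *: S) = 0 by exact: mulmx_ker.
  by rewrite mulmxBr mulmx1 -scalemxAr => /eqP; rewrite subr_eq0 => /eqP.
have K0 : mxdot (K *m S) K = 0.
  have : mxdot (K *m S) K = - mxdot (K *m S) K.
    by rewrite {1}mxdotC /mxdot trmx_mul sS mulNmx mulmxN raddfN mulmxA.
  lra.
by rewrite {1}KS mxdotZl K0 mulr0.
Qed.

Lemma cayley_curve (Q S : 'M[R]_d) : SO Q -> S^T = - S ->
  exists K : R -> 'M[R]_d, [/\ forall s, SO (K s), K 0 = Q &
    is_derive (0 : R) (1 : R) K (Q *m S)].
Proof.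
move=> [oQ dQ] sS.
pose A s := 1%:M - (s / 2) *: S.
have uA s : A s \in unitmx by exact: skew_unit.
have AT s : (A s)^T = A s + s *: S.
  rewrite /A linearB linearZ /= trmx1 sS scalerN opprK -addrA; congr (_ + _).
  by rewrite addrC -scalerBl; congr (_ *: _); field.
have AAT s : A s *m (A s)^T = (A s)^T *m A s.
  rewrite AT mulmxDl mulmxDr; congr (_ + _).
  rewrite /A mulmxBl mulmxBr mul1mx mulmx1 -!scalemxAl -!scalemxAr !scalerA.
  by rewrite (mulrC (s / 2) s).
have KE s : invmx (A s) *m (A s)^T = 1%:M + s *: (invmx (A s) *m S).
  by rewrite AT mulmxDr mulVmx // -scalemxAr.
exists (fun s => Q *m (invmx (A s) *m (A s)^T)); split.
- move=> s; split.
    rewrite trmx_mul -mulmxA (mulmxA Q^T) oQ mul1mx trmx_mul trmxK trmx_inv.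
    rewrite -mulmxA (mulmxA _ (invmx (A s))).
    have uT : (A s)^T \in unitmx by rewrite unitmx_tr.
    have -> : invmx (A s)^T *m invmx (A s) = invmx (A s) *m invmx (A s)^T.
      apply: (can_inj (mulKmx (uA s))); apply: (can_inj (mulKmx uT)).
      rewrite mulKVmx // mulmxV // !mulmxA -AAT mulmxK //.
      by rewrite mulmxV.
    by rewrite !mulmxA mulmxV // mul1mx mulVmx.
  rewrite !det_mulmx dQ mul1r det_tr det_inv mulVr //.
  by rewrite -unitmxE.
- by rewrite KE scale0r addr0 mulmx1.
pose SP := map_mx polyC S.
pose PA : 'M[{poly R}]_d := 1%:M - (2^-1 *: 'X) *: SP.
have PAE s : map_mx (horner_eval s) PA = A s.
  apply/matrixP => i j; rewrite !mxE /horner_eval /= !hornerE /=.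
  by rewrite hornerMn hornerC -[s * 2^-1]mulrC.
apply/is_derive_mxP => a b.
pose p := (map_mx polyC Q *m \adj PA *m SP) a b.
have KE' s : (Q *m invmx (A s) *m S) a b = (\det PA).[s]^-1 * p.[s].
  rewrite /invmx uA -scalemxAr -scalemxAl mxE; congr (_^-1 * _).
    by rewrite -PAE det_map_mx.
  rewrite -PAE -map_mx_adj -[p.[s]]/(horner_eval s p).
  have hE (B : 'M[R]_d) : B = map_mx (horner_eval s) (map_mx polyC B).
    by apply/matrixP => i j; rewrite !mxE /horner_eval hornerC.
  by rewrite [in LHS](hE Q) [in LHS](hE S) -!map_mxM mxE.
have -> : (fun s => (Q *m (invmx (A s) *m (A s)^T)) a b) =
    (fun s => Q a b + s * ((\det PA).[s]^-1 * p.[s])).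
  apply/funext => s; rewrite -KE' KE mulmxDr mulmx1 -scalemxAr mulmxA.
  by rewrite [LHS]mxE [X in _ + X]mxE.
have q0 : (\det PA).[0] != 0.
  have -> : (\det PA).[0] = \det (A 0) by rewrite -PAE det_map_mx.
  by rewrite -unitfE -unitmxE.
have V0 : (Q *m S) a b = (\det PA).[0]^-1 * p.[0].
  by rewrite -KE' /A mul0r scale0r subr0 invmx1 mulmx1.
have dV : is_derive (0 : R) (1 : R) (fun s => (\det PA).[s]^-1)
    (- (\det PA).[0] ^- 2 *: (\det PA)^`().[0]) by exact: is_deriveV.
have dp := is_derive_poly p 0.
have dM := is_deriveM dV dp.
have dI := is_deriveM (is_derive_id (0 : R) (1 : R)) dM.
have dC := is_deriveD (is_derive_cst (Q a b) (0 : R) (1 : R)) dI.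
apply: (@is_derive_eq _ _ _ _ _ _ _ _ dC).
by rewrite V0 add0r scale0r add0r /GRing.scale /= mulr1.
Qed.

Lemma pose_blkE X a (j : 'I_(\sum_(i < n) d)) :
  X a (rshift n j) = Rblk X (tagnat.sig1 j) a (tagnat.sig2 j).
Proof. by rewrite !mxE tagnat.sig2K. Qed.

Lemma Rblk_row_mx (T : 'M[R]_(d, n)) (B : 'I_n -> 'M[R]_d) i :
  Rblk (row_mx T (\mxrow_i B i)) i = B i.
Proof. by rewrite /Rblk row_mxKr mxrowK. Qed.

Lemma tangentE X V : tangent X V <->
  pose_mfd X /\
  forall i, ((Rblk X i)^T *m Rblk V i)^T = - ((Rblk X i)^T *m Rblk V i).
Proof.
split=> [[c [cM c0 dc]]|[XM hV]].
  split=> [|i]; first by rewrite -c0.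
  apply/eqP; rewrite -addr_eq0; apply/eqP/matrixP => a b.
  have dR k l : is_derive (0 : R) (1 : R) (fun s => Rblk (c s) i k l) (Rblk V i k l).
    have := iffLR (is_derive_mxP _ _ _ _) dc k (rshift n (tagnat.Rank i l)).
    rewrite (_ : V _ _ = Rblk V i k l); last by rewrite !mxE.
    by congr (is_derive _ _ _ _); apply/funext => s; rewrite !mxE.
  have dS := is_derive_sum (fun k => is_deriveM (dR k a) (dR k b)).
  have E : \sum_(k < d) ((fun s => Rblk (c s) i k a) * (fun s => Rblk (c s) i k b))
      = cst ((1%:M : 'M[R]_d) a b).
    apply/funext => s; have [<- _] := cM s i.
    by rewrite fct_sumE /= mxE; apply: eq_bigr => k _; rewrite [in RHS]mxE.
  rewrite E in dS.
  have := @derive_val _ _ _ _ _ _ _ dS.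
  rewrite (@derive_val _ _ _ _ _ _ _ (is_derive_cst _ _ _)) => E0.
  rewrite trmx_mul trmxK [RHS]mxE [LHS]mxE [RHS]E0.
  rewrite mxE [X in _ + X = _]mxE -big_split; apply: eq_bigr => k _ /=.
  by rewrite c0 !(mxE trmx_key) /GRing.scale /= addrC (mulrC (Rblk V i k a)).
have /choice[K hK] i := cayley_curve (XM i) (hV i).
exists (fun s => row_mx (lsubmx X + s *: lsubmx V) (\mxrow_i K i s)); split.
- by move=> s i; rewrite Rblk_row_mx; case: (hK i).
- rewrite scale0r addr0 -[RHS]hsubmxK -[in RHS](submxrowK (rsubmx X)).
  by congr row_mx; apply: eq_mxrow => i; case: (hK i).
apply/is_derive_mxP => a k; case: (split_ordP k) => j ->.
  have -> : V a (lshift _ j) = 0 + ((0 : R) *: 0 + (lsubmx V) a j *: 1).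
    by rewrite scale0r !add0r /GRing.scale /= mulr1 mxE.
  have -> : (fun s => row_mx (lsubmx X + s *: lsubmx V) (\mxrow_i K i s) a
      (lshift (\sum_(i < n) d) j)) =
      cst (lsubmx X a j) + id * cst (lsubmx V a j).
    by apply/funext => s; rewrite row_mxEl !mxE.
  apply: is_deriveD; exact: is_deriveM.
rewrite pose_blkE.
have [_ _ /is_derive_mxP/(_ a (tagnat.sig2 j))] := hK (tagnat.sig1 j).
rewrite mulmxA; have [oX _] := XM (tagnat.sig1 j); rewrite (mulmx1C oX) mul1mx.
by congr (is_derive _ _ _ _); apply/funext => s; rewrite row_mxEr mxE.
Qed.

Lemma rgradP X : pose_mfd X -> is_rgrad G X (rgrad G X).
Proof.
move=> XM; apply: xgetPex.
pose E := egrad G X; pose Q := Rblk X.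
pose H i := (Q i)^T *m Rblk E i.
pose S i := 2^-1 *: (H i - (H i)^T).
exists (row_mx (lsubmx E) (\mxrow_i (Q i *m S i))); split.
  apply/tangentE; split=> // i; rewrite Rblk_row_mx mulmxA.
  have [-> _] := XM i; rewrite mul1mx /S linearZ linearB /= trmxK.
  by rewrite -scalerN opprB.
move=> V /tangentE[_ hV]; rewrite mxdot_blk.
rewrite linearB /= row_mxKl subrr {1}/mxdot mul0mx mxtrace0 add0r.
rewrite big1 // => i _.
have -> : Rblk (E - row_mx (lsubmx E) (\mxrow_i (Q i *m S i))) i
    = Rblk E i - Q i *m S i.
  by rewrite RblkB Rblk_row_mx.
have [oX _] := XM i.
pose U := (Q i)^T *m Rblk V i.
have UT : U^T = - U by exact: hV.
have -> : Rblk V i = Q i *m U by rewrite mulmxA (mulmx1C oX) mul1mx.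
pose Y := 2^-1 *: (H i + (H i)^T).
have YT : Y^T = Y by rewrite /Y linearZ linearD /= trmxK addrC.
have -> : Rblk E i - Q i *m S i = Q i *m Y.
  have -> : Rblk E i = Q i *m H i by rewrite mulmxA (mulmx1C oX) mul1mx.
  rewrite -mulmxBr; congr (_ *m _); apply/matrixP => a b; rewrite !mxE; lra.
have -> : mxdot (Q i *m Y) (Q i *m U) = \tr (Y *m U^T).
  by rewrite /mxdot trmx_mul mxtrace_mulC -!mulmxA (mulmxA _ (Q i)) oX mul1mx mxtrace_mulC.
have : \tr (Y *m U^T) = - \tr (Y *m U^T).
  by rewrite -[in LHS]mxtrace_tr trmx_mul trmxK YT mxtrace_mulC UT mulmxN raddfN opprK.
lra.
Qed.

Lemma is_rgrad_uniq X P P' : is_rgrad G X P -> is_rgrad G X P' -> P = P'.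
Proof.
move=> [/tangentE[XM tP] oP] [/tangentE[_ tP'] oP'].
have tD : tangent X (P - P').
  apply/tangentE; split=> // i.
  by rewrite RblkB mulmxBr linearB /= tP tP' opprB opprK addrC.
apply/eqP; rewrite -subr_eq0 -mxdot_eq0.
have -> : P - P' = (egrad G X - P') - (egrad G X - P).
  by rewrite opprB [RHS]addrC addrA subrK.
rewrite {1}mxdotBl.
have -> : egrad G X - P' - (egrad G X - P) = P - P'.
  by rewrite opprB [LHS]addrC addrA subrK.
by rewrite oP // oP' // subrr.
Qed.

End PoseFacts.

(* Main.v *)
Require Import Defs.
From mathcomp Require Import all_boot all_order all_algebra.
From mathcomp Require Import all_classical all_reals all_analysis.
From mathcomp Require Import ring lra.
Set Implicit Arguments.
Unset Strict Implicit.
Unset Printing Implicit Defensive.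
Import Order.TTheory GRing.Theory Num.Theory.
Import numFieldNormedType.Exports.
Local Open Scope classical_set_scope.
Local Open Scope ring_scope.

(** Both methods are majorization-minimization schemes. The model of
    F around X,
      q_X(Z) = <egrad X, D> + 1/2 tr (D Gamma D^T)   where D := Z - X,
    satisfies F Z = F X + q_X Z - 1/2 tr (D (Gamma - Mt) D^T), since F is
    quadratic, and Gamma - Mt >= alpha I by the parallelogram inequality
    1/2 |A - B|^2 <= |A|^2 + |B|^2 applied edge by edge
    ([Gamma_subMt_ge]). Because Gamma is block diagonal over the vertices,
    completing the square in each t_i reduces the minimization of q_X over the
    pose manifold to the maximization of tr (R_i^T theta_i) over SO(d), so a GPM
    step is a global minimizer of q_X ([gpm_step_minimizes]). This has two
    consequences: comparison with Z = X gives the descent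
      F Z + 1/2 tr (D (Gamma - Mt) D^T) <= F X   ([gpm_step_descent]),
    and the first-order condition gives egrad X + D Gamma orthogonal to the
    tangent space at Z ([gpm_step_stationary]).

    GPM* is treated by the same argument: at a point whose translations are
    optimal, the translation part of egrad vanishes, hence its step from X has
    the rotations of a GPM step Z from X, followed by a reoptimization of the
    translations, which can only decrease F further and makes the total
    displacement a linear image (Z - X) B of that of the GPM step, with a fixed
    matrix B. The notion [majorized_step] captures both methods.

    If Gamma - Mt is coercive, either by positive definiteness or because
    alpha > 0, the descent bounds |Z - X|^2 by a multiple of F X - F Y, where Y is
    the new iterate. Then |Y - X| is controlled by |Z - X|. So is |rgrad Y|, as
    egrad Y = egrad X + (Z - X) B Mt differs from a vector normal to the
    manifold by (Z - X) (B Mt - Gamma) ([majorized_step_rgrad]). Since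
    F decreases and is nonnegative, F (X k) - F (X k.+1) tends to 0, and so do
    both quantities ([majorized_step_estimate]). *)

(** * Frobenius geometry and positive definite forms *)

Section FrobeniusGeometry.
Context (R : realType).

Lemma mxdotDr m p (A B B' : 'M[R]_(m, p)) :
  mxdot A (B + B') = mxdot A B + mxdot A B'.
Proof. by rewrite !(mxdotC A) mxdotDl. Qed.

Lemma mxdotZr m p a (A B : 'M[R]_(m, p)) : mxdot A (a *: B) = a * mxdot A B.
Proof. by rewrite !(mxdotC A) mxdotZl. Qed.

Lemma mxdotBr m p (A B B' : 'M[R]_(m, p)) :
  mxdot A (B - B') = mxdot A B - mxdot A B'.
Proof. by rewrite !(mxdotC A) mxdotBl. Qed.

Lemma mxdot0l m p (A : 'M[R]_(m, p)) : mxdot 0 A = 0.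
Proof. by rewrite /mxdot mul0mx mxtrace0. Qed.

(** Right multiplication by B and by B^T are adjoint; the form
    tr (A S B^T) of a symmetric S is written [mxdot (A *m S) B] throughout. *)
Lemma mxdot_mulr m p q (A : 'M[R]_(m, p)) (B : 'M[R]_(p, q)) (C : 'M[R]_(m, q)) :
  mxdot (A *m B) C = mxdot A (C *m B^T).
Proof. by rewrite /mxdot trmx_mul trmxK mulmxA. Qed.

Lemma mxdot_mulsym m p (S : 'M[R]_p) (A B : 'M[R]_(m, p)) :
  S^T = S -> mxdot (A *m S) B = mxdot (B *m S) A.
Proof. by move=> sS; rewrite mxdot_mulr sS mxdotC. Qed.

(** The quadratic form is nonnegative on the plane spanned by A and B, so its
    discriminant there is nonpositive. *)
Lemma psd_CauchySchwarz m p (S : 'M[R]_p) (A B : 'M[R]_(m, p)) :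
  S^T = S -> (forall D : 'M[R]_(m, p), 0 <= mxdot (D *m S) D) ->
  mxdot (A *m S) B ^+ 2 <= mxdot (A *m S) A * mxdot (B *m S) B.
Proof.
move=> sS pS.
have h x y : 0 <= x ^+ 2 * mxdot (A *m S) A + 2 * x * y * mxdot (A *m S) B
    + y ^+ 2 * mxdot (B *m S) B.
  have := pS (x *: A + y *: B).
  rewrite mulmxDl -!scalemxAl !(mxdotDl, mxdotDr, mxdotZl, mxdotZr).
  by rewrite (mxdot_mulsym B A sS); congr (0 <= _); ring.
move: (pS A) (pS B) h.
set a := mxdot (A *m S) A; set b := mxdot (A *m S) B.
set c := mxdot (B *m S) B => a0 c0 h.
have [cz|cp] := eqVneq c 0; last first.
  have {}cp : 0 < c by rewrite lt_def cp.
  rewrite -subr_ge0 -(pmulr_rge0 _ cp); have := h c (- b).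
  by congr (0 <= _); ring.
(* An isotropic B is orthogonal to everything: otherwise the form would take
   the value -1 at A + s B for the s chosen below. *)
have [->|bz] := eqVneq b 0; first by rewrite expr0n mulr_ge0.
have := h 1 (- (a + 1) / (2 * b)).
rewrite cz (_ : _ + _ = -1); first by rewrite oppr_ge0 ler10.
by field.
Qed.

Lemma mxdot_CauchySchwarz m p (A B : 'M[R]_(m, p)) :
  mxdot A B ^+ 2 <= mxdot A A * mxdot B B.
Proof.
have := @psd_CauchySchwarz _ _ 1%:M A B; rewrite !mulmx1; apply.
  exact: trmx1.
by move=> D; rewrite mulmx1 mxdot_ge0.
Qed.

(** Submultiplicativity of the Frobenius norm: Cauchy-Schwarz on each entry
    of the product. *)
Lemma mxdot_mulmx_le m p q (A : 'M[R]_(m, p)) (B : 'M[R]_(p, q)) :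
  mxdot (A *m B) (A *m B) <= mxdot A A * mxdot B B.
Proof.
have rowE k l (C : 'M[R]_(k, l)) : mxdot C C = \sum_i mxdot (row i C) (row i C).
  rewrite mxdotE; apply: eq_bigr => i _.
  by rewrite mxdotE big_ord1; apply: eq_bigr => j _; rewrite mxE.
have BT : mxdot B B = mxdot B^T B^T by rewrite /mxdot mxtrace_mulC trmxK.
rewrite BT (rowE _ _ A) (rowE _ _ B^T) mxdotE big_distrl; apply: ler_sum => i _ /=.
rewrite big_distrr; apply: ler_sum => j _ /=; rewrite -expr2.
have -> : (A *m B) i j = mxdot (row i A) (row j B^T).
  by rewrite mxdotE big_ord1 mxE; apply: eq_bigr => k _; rewrite !mxE.
exact: mxdot_CauchySchwarz.
Qed.

(** The hypothesis says that A is an orthogonal projection of B on some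
    subspace, and projections do not increase the norm. *)
Lemma mxdot_le_of_pairing m p (A B : 'M[R]_(m, p)) :
  mxdot A A = mxdot B A -> mxdot A A <= mxdot B B.
Proof.
move=> h; have := mxdot_ge0 A; rewrite le_eqVlt => /predU1P[<-|A0].
  exact: mxdot_ge0.
rewrite -(ler_pM2r A0) -expr2 {1}h; exact: mxdot_CauchySchwarz.
Qed.

Lemma posdefmx_unit p (S : 'M[R]_p) : posdefmx S -> S \in unitmx.
Proof.
move=> [_ pS]; rewrite -row_free_unit -kermx_eq0; apply/eqP/row_matrixP => i.
rewrite row0; apply/eqP; apply: contraT => ri.
have ri0 : row i (kermx S) *m S = 0 by apply/sub_kermxP; exact: row_sub.
have := pS (row i (kermx S))^T; rewrite trmxK ri0 mul0mx mxtrace0 ltxx; apply.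
by apply: contraNneq ri => /(congr1 trmx); rewrite trmxK trmx0 => ->.
Qed.

Lemma posdefmx_psd m p (S : 'M[R]_p) : posdefmx S ->
  forall D : 'M[R]_(m, p), 0 <= mxdot (D *m S) D.
Proof.
move=> [_ pS] D; apply: sumr_ge0 => i _.
have -> : (D *m S *m D^T) i i = \tr ((row i D)^T^T *m S *m (row i D)^T).
  rewrite trmxK -row_mul tr_row -row_mul -/(mxtrace _) /mxtrace big_ord1.
  by rewrite -tr_row !mxE; apply: eq_bigr => j _; rewrite !mxE.
have [->|nz] := eqVneq (row i D)^T 0; first by rewrite mulmx0 mxtrace0.
exact/ltW/pS.
Qed.

(** Cauchy-Schwarz for the form of S, applied to D and E := D S^-1, bounds
    |D|^4 = <E S, D>^2 by <E S, E> <D S, D>, and <E S, E> = <D, E> is at most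
    |D|^2 |S^-1|; so c = |S^-1| works. *)
Lemma posdefmx_coercive m p (S : 'M[R]_p) : posdefmx S ->
  exists2 c, 0 <= c & forall D : 'M[R]_(m, p), mxdot D D <= c * mxdot (D *m S) D.
Proof.
move=> pS; have uS := posdefmx_unit pS; have psS := @posdefmx_psd m _ _ pS.
exists (frob (invmx S)) => [|D]; first exact: sqrtr_ge0.
have := mxdot_ge0 D; rewrite le_eqVlt => /predU1P[<-|D0].
  by rewrite mulr_ge0 ?sqrtr_ge0.
set E := D *m invmx S; have ES : E *m S = D by rewrite mulmxKV.
have EE : mxdot (E *m S) E <= mxdot D D * frob (invmx S).
  rewrite -ler_sqr ?nnegrE ?psS ?mulr_ge0 ?mxdot_ge0 ?sqrtr_ge0 // ES.
  apply: le_trans (mxdot_CauchySchwarz _ _) _.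
  rewrite exprMn frob_sqr expr2 -mulrA ler_wpM2l ?mxdot_ge0 //.
  exact: mxdot_mulmx_le.
rewrite -(ler_pM2l D0) mulrA.
apply: le_trans (ler_wpM2r (psS D) EE).
by rewrite -expr2 -{1}ES; exact: psd_CauchySchwarz pS.1 psS.
Qed.

End FrobeniusGeometry.

(** * The quadratic model of the objective *)

Section Majorization.
Context (R : realType) (d n : nat) (G : pgo_data R d n).
Implicit Types X Y Z D V : 'M[R]_(d, pose_dim d n).

Lemma pgoF_ge0 X : 0 <= pgoF G X.
Proof.
apply: sumr_ge0 => e eE; rewrite mulr_ge0 ?invr_ge0 ?ler0n // addr_ge0 //.
  by rewrite mulr_ge0 ?sqr_ge0 ?kap_ge0.
by rewrite mulr_ge0 ?sqr_ge0 ?ltW ?tau_gt0.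
Qed.

Lemma pgoF_quad D : pgoF G D = 2^-1 * mxdot (D *m Mt G) D.
Proof. by have [_ ->] := MtP G. Qed.

Lemma frobB_sqr_le m p (A B : 'M[R]_(m, p)) :
  2^-1 * frob (A - B) ^+ 2 <= frob A ^+ 2 + frob B ^+ 2.
Proof.
have := mxdot_ge0 (A + B); rewrite !frob_sqr.
by rewrite !(mxdotBl, mxdotBr, mxdotDl, mxdotDr) (mxdotC B A); lra.
Qed.

Lemma frob_mul_SO m (A : 'M[R]_(m, d)) (Q : 'M[R]_d) :
  SO Q -> frob (A *m Q) = frob A.
Proof.
move=> [oQ _]; rewrite /frob; congr Num.sqrt.
by rewrite mxdot_mulr -mulmxA (mulmx1C oQ) mulmx1.
Qed.

(** The parallelogram inequality on each edge; rotating R_i by the measurement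
    does not change its norm. *)
Lemma pgoF_le_omegaQ D : pgoF G D <= omegaQ G D.
Proof.
apply: ler_sum => e eE; rewrite mulrDr; apply: lerD; rewrite mulrCA.
  rewrite ler_wpM2l ?kap_ge0 // -(frob_mul_SO (Rblk D e.1) (mrot_SO eE)).
  exact: frobB_sqr_le.
apply: ler_wpM2l; first exact/ltW/tau_gt0.
exact: frobB_sqr_le.
Qed.

Lemma Gamma_subMt_ge alpha D :
  alpha * mxdot D D <= mxdot (D *m (Gamma G alpha - Mt G)) D.
Proof.
have [_ qO] := OmegaP G; have [_ qM] := MtP G; have := pgoF_le_omegaQ D.
rewrite qO qM ler_pM2l ?invr_gt0 ?ltr0n // -!/(mxdot _ _).
rewrite /Gamma mulmxBr mulmxDr mul_mx_scalar mxdotBl mxdotDl mxdotZl; lra.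
Qed.

(** A zero of F is a global minimizer of F, as F is nonnegative; it is
    therefore a critical point of the Euclidean problem. *)
Lemma pgoF_eq0_egrad X : pgoF G X = 0 -> egrad G X = 0.
Proof.
rewrite pgoF_quad => F0; apply/eqP; rewrite -mxdot_eq0 -sqrf_eq0.
rewrite eq_le sqr_ge0 andbT /egrad.
have [sM _] := MtP G.
apply: le_trans (psd_CauchySchwarz X (X *m Mt G) sM _) _ => [D|].
  by have := pgoF_ge0 D; rewrite pgoF_quad pmulr_rge0 // invr_gt0 ltr0n.
have -> : mxdot (X *m Mt G) X = 0 by move: F0; lra.
by rewrite mul0r.
Qed.

(** By connectivity each of the at least two vertices has an incident edge,
    and its weight tau is positive. This makes the translation subproblem
    of a step strictly convex. *)
Lemma Gtau_gt0 alpha i : (1 < n)%N -> 0 <= alpha -> 0 < Gtau G alpha i.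
Proof.
move=> n1 a0.
have [j ji] : exists j : 'I_n, j != i.
  have [<-|] := eqVneq (Ordinal n1) i; last by exists (Ordinal n1).
  by exists (Ordinal (ltnW n1)).
have [e eE ei] : exists2 e, e \in edges G & (e.1 == i) || (e.2 == i).
  have /connectP[[|k p]] := edges_connected G i j.
    by move=> _ /= ij; rewrite ij eqxx in ji.
  move=> /= /andP[/orP[h|h] _] _.
    by exists (i, k); rewrite //= eqxx.
  by exists (k, i); rewrite //= eqxx orbT.
have t0 f : f \in edges G -> 0 < 2 * tau G f.
  by move=> fE; rewrite mulr_gt0 ?ltr0n ?tau_gt0.
rewrite /Gtau (bigD1 e) /=; last by rewrite eE.
rewrite ltr_wpDl // ltr_pwDl ?t0 //.
by apply: sumr_ge0 => f /andP[/andP[fE _] _]; exact/ltW/t0.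
Qed.

Lemma mxdot_pose X Y : mxdot X Y =
  \sum_i (mxdot (tblk X i) (tblk Y i) + mxdot (Rblk X i) (Rblk Y i)).
Proof.
rewrite mxdot_blk big_split /=; congr (_ + _).
rewrite mxdotE exchange_big; apply: eq_bigr => i _.
by rewrite mxdotE; apply: eq_bigr => a _; rewrite big_ord1 !mxE.
Qed.

Lemma tblkB X Y i : tblk (X - Y) i = tblk X i - tblk Y i.
Proof. by rewrite !tblk_mul mulmxBl. Qed.

Lemma Grho_sym alpha i : (Grho G alpha i)^T = Grho G alpha i.
Proof.
rewrite /Grho !linearD /= !tr_scalar_mx linear_sum; congr (_ + _).
by apply: eq_bigr => e _; rewrite linearZ /= trmx_mul trmxK.
Qed.

Lemma Gamma_sym alpha : (Gamma G alpha)^T = Gamma G alpha.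
Proof. by rewrite /Gamma linearD /= tr_scalar_mx; have [-> _] := OmegaP G. Qed.

Context (alpha : R).

Definition gpm_model X Z : R :=
  mxdot (egrad G X) (Z - X) + 2^-1 * mxdot ((Z - X) *m Gamma G alpha) (Z - X).

(** The residual of the optimality condition in t_i: the step formula for the
    translations says exactly that it vanishes. *)
Definition gpm_tshift X Z i : 'cV[R]_d :=
  tblk Z i - tblk X i
  + (Gtau G alpha i)^-1 *: ((Rblk Z i - Rblk X i) *m Gnu G i + tblk (egrad G X) i).

(** The Schur complement C of the translation weight appears when the square
    in w is completed; here w and p stand for the displacements of t_i and R_i,
    and g and h for the corresponding parts of the gradient. *)
Lemma complete_square (a : R) (v : 'cV[R]_d) (P p h : 'M[R]_d) (g w : 'cV[R]_d) :
  a != 0 ->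
  let C := P - a^-1 *: (v *m v^T) in
  let u := w + a^-1 *: (p *m v + g) in
  mxdot g w + mxdot h p + 2^-1 * (a * mxdot w w + 2 * mxdot (p *m v) w + mxdot (p *m P) p)
  = a / 2 * mxdot u u - (2 * a)^-1 * mxdot g g
    + mxdot (h - a^-1 *: (g *m v^T)) p + 2^-1 * mxdot (p *m C) p.
Proof.
move=> a0 C u; rewrite /C /u.
rewrite mulmxBr -scalemxAr mulmxA !(mxdotDl, mxdotDr, mxdotNl, mxdotZl, mxdotZr).
rewrite (mxdot_mulr (p *m v)) (mxdot_mulr g) trmxK.
rewrite (mxdotC g w) (mxdotC g (p *m v)) (mxdotC w (p *m v)).
by field.
Qed.

(** On the manifold the term <Z_i C, Z_i> equals tr C, a constant, so what
    remains of the rotation part of the model is linear in Z_i, with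
    coefficient - theta_i. *)
Lemma gpm_model_blocks (hn : (1 < n)%N) (ha : 0 <= alpha) X :
  exists K : R, forall Z, pose_mfd Z ->
  gpm_model X Z = K + \sum_i
    (Gtau G alpha i / 2 * mxdot (gpm_tshift X Z i) (gpm_tshift X Z i)
     - \tr ((Rblk Z i)^T *m theta_gpm G alpha X i)).
Proof.
pose C i := Grho G alpha i - (Gtau G alpha i)^-1 *: (Gnu G i *m (Gnu G i)^T).
pose H i := Rblk (egrad G X) i
  - (Gtau G alpha i)^-1 *: (tblk (egrad G X) i *m (Gnu G i)^T).
exists (\sum_i (2^-1 * \tr (C i) + 2^-1 * mxdot (Rblk X i *m C i) (Rblk X i)
   - mxdot (H i) (Rblk X i)
   - (2 * Gtau G alpha i)^-1 * mxdot (tblk (egrad G X) i) (tblk (egrad G X) i))).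
move=> Z ZM.
rewrite /gpm_model mxdot_pose [X in 2^-1 * X]Gamma_blk mulr_sumr -!big_split.
apply: eq_bigr => i _ /=; rewrite frob_sqr tblkB RblkB complete_square; last first.
  by rewrite gt_eqF // Gtau_gt0.
rewrite -/(C i) -/(H i) -/(gpm_tshift X Z i).
have Cs : (C i)^T = C i.
  by rewrite /C linearB linearZ /= Grho_sym trmx_mul trmxK.
have ZZ : mxdot (Rblk Z i *m C i) (Rblk Z i) = \tr (C i).
  by have [oZ _] := ZM i; rewrite /mxdot -mulmxA mxtrace_mulC -mulmxA oZ mulmx1.
have -> : \tr ((Rblk Z i)^T *m theta_gpm G alpha X i)
    = mxdot (Rblk X i *m C i) (Rblk Z i) - mxdot (H i) (Rblk Z i).
  rewrite -mxdotBl mxdotC /mxdot -[RHS]mxtrace_tr trmx_mul trmxK mxtrace_mulC.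
  by rewrite /theta_gpm /H opprB addrA.
rewrite mulmxBl !(mxdotBl, mxdotBr) ZZ (mxdot_mulsym (Rblk Z i) _ Cs).
by field; rewrite gt_eqF // Gtau_gt0.
Qed.

End Majorization.

(** * Descent and stationarity of a step *)

Section Descent.
Context (R : realType).

(** Fermat's rule at 0 for a function that is differentiable at that single
    point, which is all that the curves defining tangent vectors provide. *)
Lemma is_derive_ge_eq0 (f : R -> R) (m : R) :
  is_derive (0 : R) (1 : R) f m -> (forall s, f 0 <= f s) -> m = 0.
Proof.
move=> [df dE] fmin.
have q : h^-1 *: (f (h *: 1 + 0) - f 0) @[h --> (0 : R)^'] --> m.
  by rewrite -dE; exact: df.
apply/eqP; apply: contraT => m0.
have := q; move/cvgrPdist_lt => /(_ `|m|); rewrite normr_gt0 => /(_ m0).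
move=> [e /= e0 he].
(* A small step against the sign of the slope m: the difference quotient has
   the sign of that step, hence cannot be |m|-close to m. *)
pose h := if 0 < m then - (e / 2) else e / 2.
have h0 : h != 0 by rewrite /h; case: ifP; rewrite ?oppr_eq0 gt_eqF ?divr_gt0.
have hb : ball_ Num.norm 0 e h.
  rewrite /= sub0r normrN /h; have : e / 2 < e by lra.
  by case: ifP => _; rewrite ?normrN gtr0_norm ?divr_gt0.
have mh : m * h <= 0 by rewrite /h; case: ltrP => m1; nra.
have := he _ hb h0; rewrite /= /GRing.scale /= mulr1 addr0.
set y := h^-1 * _; apply: contraLR => _.
rewrite -leNgt -ler_sqr ?nnegrE // !real_normK ?num_real //.
have my : m * y <= 0.
  have -> : m * y = (m * h) * (h^-1 ^+ 2 * (f h - f 0)) by rewrite /y; field.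
  by rewrite mulr_le0_ge0 // mulr_ge0 ?sqr_ge0 // subr_ge0.
by have := sqr_ge0 y; rewrite sqrrB; lra.
Qed.

Lemma is_derive_mxdot m p (a b : R -> 'M[R]_(m, p)) (x : R) a' b' :
  is_derive x (1 : R) a a' -> is_derive x (1 : R) b b' ->
  is_derive x (1 : R) (fun s => mxdot (a s) (b s)) (mxdot a' (b x) + mxdot (a x) b').
Proof.
move=> /is_derive_mxP da /is_derive_mxP db.
have dS := is_derive_sum (fun i => is_derive_sum (fun j => is_deriveM (da i j) (db i j))).
have -> : (fun s => mxdot (a s) (b s)) =
    \sum_i \sum_j ((fun s => a s i j) * (fun s => b s i j)).
  apply/funext => s; rewrite mxdotE fct_sumE; apply: eq_bigr => i _.
  by rewrite fct_sumE.
apply: (@is_derive_eq _ _ _ _ _ _ _ _ dS).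
rewrite !mxdotE -big_split; apply: eq_bigr => i _; rewrite -big_split.
by apply: eq_bigr => j _; rewrite /GRing.scale /= addrC (mulrC (b x i j)).
Qed.

Lemma is_derive_mulmxr m p q (a : R -> 'M[R]_(m, p)) (B : 'M[R]_(p, q)) (x : R) a' :
  is_derive x (1 : R) a a' -> is_derive x (1 : R) (fun s => a s *m B) (a' *m B).
Proof.
move=> /is_derive_mxP da; apply/is_derive_mxP => i j.
have dS := is_derive_sum (fun k => is_deriveZ (B k j) (da i k)).
have -> : (fun s => (a s *m B) i j) =
    \sum_k (B k j \*: (fun s => a s i k)).
  apply/funext => s; rewrite fct_sumE mxE; apply: eq_bigr => k _.
  by rewrite /= /GRing.scale /= mulrC.
apply: (@is_derive_eq _ _ _ _ _ _ _ _ dS).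
by rewrite mxE; apply: eq_bigr => k _; rewrite /GRing.scale /= mulrC.
Qed.

Context (d n : nat) (G : pgo_data R d n) (alpha : R).
Context (hn : (1 < n)%N) (ha : 0 <= alpha).
Implicit Types X Y Z D V W : 'M[R]_(d, pose_dim d n).

(** The two kinds of terms of [gpm_model_blocks] are minimized separately: the
    translation formula makes every square vanish, and the choice of the
    rotations makes every linear term minimal. *)
Lemma gpm_step_minimizes X Z : gpm_step G alpha X Z ->
  pose_mfd Z /\ forall W, pose_mfd W -> gpm_model G alpha X Z <= gpm_model G alpha X W.
Proof.
move=> XZ; have ZM : pose_mfd Z by move=> i; have [[]] := XZ i.
split=> // W WM; have [K KE] := gpm_model_blocks G hn ha X.
rewrite !KE // lerD2l; apply: ler_sum => i _.
have [[_ maxZ] tZ] := XZ i.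
have -> : gpm_tshift G alpha X Z i = 0.
  rewrite /gpm_tshift tZ mulmxBl scalerBr scalerDr scalerBr.
  set a := (_ *: (Rblk Z i *m _)); set b := (_ *: (Rblk X i *m _)).
  by apply/matrixP => k l; rewrite !mxE; ring.
rewrite mxdot0l mulr0; apply: lerB; last exact: maxZ.
by rewrite mulr_ge0 ?mxdot_ge0 // divr_ge0 // ltW // Gtau_gt0.
Qed.

Lemma gpm_model_shift X Z D : gpm_model G alpha X (Z + D) =
  gpm_model G alpha X Z + mxdot (egrad G X + (Z - X) *m Gamma G alpha) D
  + 2^-1 * mxdot (D *m Gamma G alpha) D.
Proof.
rewrite /gpm_model (addrAC Z D) -/(Z - X); move: (Z - X) => W.
rewrite mulmxDl !(mxdotDl, mxdotDr) (mxdot_mulsym D _ (Gamma_sym G alpha)).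
by field.
Qed.

(** First-order optimality of the minimizer Z along the curve that defines the
    tangent vector V; the vector paired with V is the gradient of the model
    at Z. *)
Lemma gpm_step_stationary X Z V : gpm_step G alpha X Z -> tangent Z V ->
  mxdot (egrad G X + (Z - X) *m Gamma G alpha) V = 0.
Proof.
move=> /gpm_step_minimizes[ZM Zmin] [c [cM c0 dc]].
set E := egrad G X + _.
pose D s := c s - Z.
have D0 : D 0 = 0 by rewrite /D c0 subrr.
have dD : is_derive (0 : R) (1 : R) D V.
  by have := is_deriveB dc (is_derive_cst Z (0 : R) (1 : R)); rewrite subr0.
have d1 := is_derive_mxdot (is_derive_cst E (0 : R) (1 : R)) dD.
have d2 := is_deriveZ 2^-1
  (is_derive_mxdot (is_derive_mulmxr (Gamma G alpha) dD) dD).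
have := is_deriveD d1 d2.
rewrite D0 mul0mx !mxdot0l (mxdotC _ 0) mxdot0l !addr0 scaler0 addr0 add0r.
move/is_derive_ge_eq0; apply => s.
rewrite -[_ 0]/(mxdot E (D 0) + 2^-1 * mxdot (D 0 *m Gamma G alpha) (D 0)).
rewrite -[_ s]/(mxdot E (D s) + 2^-1 * mxdot (D s *m Gamma G alpha) (D s)).
rewrite D0 mul0mx mxdot0l mxdotC mxdot0l mulr0 addr0.
have cE : c s = Z + D s by rewrite /D addrC addrNK.
by have := Zmin _ (cM s); rewrite cE gpm_model_shift -/E -addrA lerDl.
Qed.

(** The model and F have the same linear part at X, and their quadratic parts
    differ by Gamma - Mt. *)
Lemma pgoF_gpm_model X Z : pgoF G Z = pgoF G X + gpm_model G alpha X Z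
  - 2^-1 * mxdot ((Z - X) *m (Gamma G alpha - Mt G)) (Z - X).
Proof.
rewrite -{1}(addrNK X Z) addrC pgoFD (pgoF_quad G (Z - X)) /gpm_model.
rewrite mulmxBr mxdotBl; ring.
Qed.

Lemma gpm_step_descent X Z : pose_mfd X -> gpm_step G alpha X Z ->
  pgoF G Z + 2^-1 * mxdot ((Z - X) *m (Gamma G alpha - Mt G)) (Z - X) <= pgoF G X.
Proof.
move=> XM /gpm_step_minimizes[_ /(_ _ XM)].
rewrite (pgoF_gpm_model X Z) subrK {2}/gpm_model subrr mul0mx mxdot0l.
by rewrite mxdotC mxdot0l mulr0 addr0 gerDl.
Qed.

End Descent.

(** * Iterates of both methods *)

Section Iterates.
Context (R : realType) (d n : nat) (G : pgo_data R d n) (alpha : R).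
Context (hn : (1 < n)%N) (ha : 0 <= alpha).
Implicit Types X Y Z D V W : 'M[R]_(d, pose_dim d n).

(** One iteration of either method: a GPM step Z, then a change of translations
    that does not increase F and makes the total displacement a fixed linear
    function of that of the GPM step. Tangent spaces at Y and Z coincide because
    they depend only on the rotations. *)
Definition majorized_step (B : 'M[R]_(pose_dim d n)) X Y : Prop :=
  exists Z, [/\ gpm_step G alpha X Z, forall i, Rblk Y i = Rblk Z i,
    pgoF G Y <= pgoF G Z & Y - X = (Z - X) *m B].

Lemma gpm_step_majorized X Y : gpm_step G alpha X Y -> majorized_step 1%:M X Y.
Proof. by move=> XY; exists Y; split=> //; rewrite mulmx1. Qed.

Lemma lsubmx_egrad X :
  lsubmx (egrad G X) = lsubmx X *m Lmx G + rsubmx X *m (Vmx G)^T.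
Proof.
have [sM _] := MtP G.
have -> : (Vmx G)^T = dlsubmx (Mt G) by rewrite /Vmx trmx_ursub sM.
rewrite /egrad -{1}(hsubmxK X) -{1}(submxK (Mt G)) mul_row_block row_mxKl.
by rewrite /Lmx.
Qed.

(** A pure translation X = (A, 0) with A L = 0 has F X = 0, so all of its
    gradient vanishes, including the rotation part A V. *)
Lemma ker_Lmx (A : 'M[R]_(d, n)) : A *m Lmx G = 0 -> A *m Vmx G = 0.
Proof.
move=> AL; pose X : 'M[R]_(d, pose_dim d n) := row_mx A 0.
have XE : X *m Mt G = row_mx (A *m Lmx G) (A *m Vmx G).
  by rewrite -(submxK (Mt G)) mul_row_block !mul0mx !addr0.
have /pgoF_eq0_egrad : pgoF G X = 0.
  rewrite pgoF_quad XE AL /mxdot tr_row_mx mul_row_col mul0mx add0r trmx0.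
  by rewrite mulmx0 mxtrace0 mulr0.
by rewrite /egrad XE AL => /(congr1 rsubmx); rewrite row_mxKr linear0.
Qed.

(** The translation part of the gradient at t = - R V^T L^+ is R V^T N, with N
    the orthogonal projection on the kernel of L; it vanishes by [ker_Lmx],
    so t is a genuine minimizer although L is singular. *)
Lemma t_opt_lsubmx_egrad X : t_opt G X -> lsubmx (egrad G X) = 0.
Proof.
move=> tX; have [LPL PLP sLP sPL] := mp_pinvP (Lmx G).
have LT : (Lmx G)^T = Lmx G by rewrite /Lmx trmx_ulsub; have [-> _] := MtP G.
set P := mp_pinv (Lmx G) in LPL PLP sLP sPL.
pose W := rsubmx X *m (Vmx G)^T *m (1%:M - P *m Lmx G).
have WE : lsubmx (egrad G X) = W.
  by rewrite lsubmx_egrad tX /W mulmxBr mulmx1 mulNmx addrC -!mulmxA.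
have NT : (1%:M - P *m Lmx G)^T = 1%:M - P *m Lmx G by rewrite linearB /= trmx1 sPL.
have NN : (1%:M - P *m Lmx G) *m (1%:M - P *m Lmx G) = 1%:M - P *m Lmx G.
  by rewrite mulmxBr mulmx1 mulmxBl mul1mx mulmxA PLP subrr subr0.
have NL : (1%:M - P *m Lmx G) *m Lmx G = 0.
  by rewrite -{2}LT -[LHS]trmxK trmx_mul NT trmxK mulmxBr mulmx1 mulmxA LPL subrr trmx0.
have WL : W *m Lmx G = 0 by rewrite /W -mulmxA NL mulmx0.
have WN : W *m (1%:M - P *m Lmx G) = W by rewrite /W -mulmxA NN.
rewrite WE; apply/eqP; rewrite -mxdot_eq0 {2}/W /mxdot trmx_mul NT.
rewrite mulmxA WN.
by rewrite trmx_mul trmxK mulmxA (ker_Lmx WL) mul0mx mxtrace0.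
Qed.

Lemma gpm_step_ex X Y : (forall i, argmax_SO (theta_gpm G alpha X i) (Rblk Y i)) ->
  exists2 Z, gpm_step G alpha X Z & rsubmx Z = rsubmx Y.
Proof.
move=> maxY.
pose t i := tblk X i - (Gtau G alpha i)^-1 *: (Rblk Y i *m Gnu G i)
  + (Gtau G alpha i)^-1 *: (Rblk X i *m Gnu G i - tblk (egrad G X) i).
exists (row_mx (\matrix_(a, i) t i a 0) (rsubmx Y)); last by rewrite row_mxKr.
have RE i : Rblk (row_mx (\matrix_(a, i) t i a 0) (rsubmx Y)) i = Rblk Y i.
  by rewrite /Rblk row_mxKr.
move=> i; rewrite RE; split=> //; rewrite -/(t i).
by apply/matrixP => a j; rewrite ord1 /tblk row_mxKl !mxE.
Qed.

(** Maps a displacement (dt, dR) to (- dR V^T L^+, dR): the translations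
    follow the rotations and the old displacement dt is forgotten. *)
Definition t_opt_response : 'M[R]_(pose_dim d n) :=
  block_mx 0 0 (- ((Vmx G)^T *m mp_pinv (Lmx G))) 1%:M.

(** At X the translation part of the gradient vanishes, so both methods use the
    same theta_i. At Y it vanishes as well, so that expanding F at Y shows that no
    change of the translations alone improves on Y. *)
Lemma gpm_star_step_majorized X Y : t_opt G X -> gpm_star_step G alpha X Y ->
  majorized_step t_opt_response X Y.
Proof.
move=> tX [maxY tY].
have [i|Z XZ ZY] := @gpm_step_ex X Y.
  have -> : theta_gpm G alpha X i = theta_gpm_star G alpha X i; last exact: maxY.
  rewrite /theta_gpm /tblk t_opt_lsubmx_egrad // linear0 mul0mx scaler0.
  by rewrite addr0.
have RYZ i : Rblk Y i = Rblk Z i by rewrite /Rblk ZY.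
exists Z; split=> //.
- rewrite -(subrKC Y Z) pgoFD -addrA lerDl.
  rewrite mxdot_blk t_opt_lsubmx_egrad // mxdot0l add0r big1 ?add0r ?pgoF_ge0 //.
  by move=> i _; rewrite RblkB RYZ subrr mxdotC mxdot0l.
- rewrite -(hsubmxK (Z - X)) mul_row_block !mulmx0 !add0r mulmx1 mulmxN.
  rewrite linearB /= ZY -[LHS]hsubmxK !linearB /= tY tX.
  by congr row_mx; rewrite mulmxA !mulmxBl opprB opprK addrC.
Qed.

Lemma majorized_step_mfd B X Y : majorized_step B X Y -> pose_mfd Y.
Proof.
by move=> [Z [/(gpm_step_minimizes hn ha)[ZM _] RY _ _]] i; rewrite RY.
Qed.

Lemma Gamma_subMt_coercive : 0 < alpha ->
  exists2 c, 0 <= c & forall D,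
    mxdot D D <= c * mxdot (D *m (Gamma G alpha - Mt G)) D.
Proof.
move=> a0; exists alpha^-1 => [|D]; first by rewrite invr_ge0 ltW.
by rewrite ler_pdivlMl // Gamma_subMt_ge.
Qed.

Lemma majorized_step_nonincr B X Y : pose_mfd X -> majorized_step B X Y ->
  pgoF G Y <= pgoF G X.
Proof.
move=> XM [Z [XZ _ YZ _]]; apply: le_trans YZ _.
apply: le_trans (gpm_step_descent hn ha XM XZ); rewrite lerDl.
rewrite mulr_ge0 ?invr_ge0 ?ler0n //.
by apply: le_trans (Gamma_subMt_ge G alpha _); rewrite mulr_ge0 ?mxdot_ge0.
Qed.

Lemma tangent_Rblk Y Z V : (forall i, Rblk Y i = Rblk Z i) ->
  tangent Y V -> tangent Z V.
Proof.
move=> E /tangentE[YM h]; by apply/tangentE; split=> i; rewrite -E.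
Qed.

(** Paired with a tangent vector at Y, egrad Y = egrad X + (Z - X) B Mt and
    (Z - X) (B Mt - Gamma) agree, by stationarity at Z; hence rgrad Y is the
    projection of the latter. *)
Lemma majorized_step_rgrad B X Y Z : gpm_step G alpha X Z ->
  (forall i, Rblk Y i = Rblk Z i) -> Y - X = (Z - X) *m B ->
  mxdot (rgrad G Y) (rgrad G Y)
    <= mxdot (Z - X) (Z - X) * mxdot (B *m Mt G - Gamma G alpha) (B *m Mt G - Gamma G alpha).
Proof.
move=> XZ RY YX.
have [ZM _] := gpm_step_minimizes hn ha XZ.
have YM : pose_mfd Y by move=> i; rewrite RY.
have [tP oP] := rgradP G YM.
apply: le_trans (mxdot_mulmx_le _ _).
apply: mxdot_le_of_pairing; apply/esym/eqP.
have : mxdot (egrad G Y) (rgrad G Y) - mxdot (rgrad G Y) (rgrad G Y) = 0.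
  by rewrite -mxdotBl oP.
have := gpm_step_stationary hn ha XZ (tangent_Rblk RY tP).
have -> : egrad G Y = egrad G X + (Z - X) *m B *m Mt G.
  by rewrite -YX /egrad -mulmxDl addrC subrK.
rewrite mulmxBr mxdotBl !mxdotDl mulmxA; lra.
Qed.

(** Coercivity turns the descent of F into a bound on the GPM displacement,
    of which both quantities are controlled by bounded linear images. *)
Lemma majorized_step_estimate B :
  (exists2 c, 0 <= c & forall D,
     mxdot D D <= c * mxdot (D *m (Gamma G alpha - Mt G)) D) ->
  exists C, forall X Y, pose_mfd X -> majorized_step B X Y ->
    mxdot (Y - X) (Y - X) <= C * (pgoF G X - pgoF G Y) /\
    mxdot (rgrad G Y) (rgrad G Y) <= C * (pgoF G X - pgoF G Y).
Proof.
move=> [c c0 hc].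
set b := mxdot B B.
set g := mxdot (B *m Mt G - Gamma G alpha) (B *m Mt G - Gamma G alpha).
have [b0 g0] : 0 <= b /\ 0 <= g by rewrite !mxdot_ge0.
exists (2 * c * (b + g)) => X Y XM [Z [XZ RY YZ YX]].
set D := Z - X.
have hD : mxdot D D <= 2 * c * (pgoF G X - pgoF G Y).
  apply: le_trans (hc D) _; rewrite (mulrC 2) -mulrA ler_wpM2l //.
  by have := gpm_step_descent hn ha XM XZ; rewrite -/D; lra.
have D0 := mxdot_ge0 D.
have -> : 2 * c * (b + g) * (pgoF G X - pgoF G Y)
    = 2 * c * (pgoF G X - pgoF G Y) * (b + g) by rewrite mulrAC.
split.
  rewrite YX; apply: le_trans (mxdot_mulmx_le _ _) _.
  by apply: ler_pM; rewrite ?mxdot_ge0 // lerDl.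
apply: le_trans (majorized_step_rgrad XZ RY YX) _.
by apply: ler_pM; rewrite ?mxdot_ge0 // lerDr.
Qed.

End Iterates.

(** * Passage to the limit *)

Section Limits.
Context (R : realType).

Lemma cvg_decrement0 (F : nat -> R) (l C : R) : F k @[k --> \oo] --> l ->
  C * (F k - F k.+1) @[k --> \oo] --> (0 : R).
Proof.
move=> Fl; rewrite -(mulr0 C) -(subrr l); apply: cvgM; first exact: cvg_cst.
by apply: cvgB => //; rewrite (cvg_shiftS F).
Qed.

Lemma frob_cvg0 m p (A : nat -> 'M[R]_(m, p)) :
  mxdot (A k) (A k) @[k --> \oo] --> (0 : R) -> frob (A k) @[k --> \oo] --> (0 : R).
Proof.
move=> h; rewrite -[X in _ --> X]sqrtr0.
apply: (@continuous_cvg _ R R _ _ (fun k => mxdot (A k) (A k)) Num.sqrt) h.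
exact: sqrt_continuous.
Qed.

(** The topology on matrices is that of the max norm, which the Frobenius norm
    dominates. *)
Lemma mx_cvg0 m p (A : nat -> 'M[R]_(m, p)) :
  frob (A k) @[k --> \oo] --> (0 : R) -> A k @[k --> \oo] --> (0 : 'M[R]_(m, p)).
Proof.
move=> h; apply/cvgrPdist_lt => e e0.
move/cvgrPdist_lt : h => /(_ e e0); apply: filterS => k /=.
rewrite !sub0r !normrN ger0_norm ?sqrtr_ge0 //; apply: le_lt_trans.
rewrite /Num.norm /= mx_normrE; apply: bigmax_le => [|[i j] _]; first exact: sqrtr_ge0.
rewrite -sqrtr_sqr ler_wsqrtr // mxdotE (bigD1 i) //= (bigD1 j) //= -addrA -expr2.
rewrite lerDl addr_ge0 ?sumr_ge0 // => ? _; rewrite ?sumr_ge0 // -?expr2 ?sqr_ge0 // => ? _.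
by rewrite -expr2 sqr_ge0.
Qed.

End Limits.

Theorem theorem3 (R : realType) (d n : nat) (hd : (1 <= d)%N) (hn : (2 <= n)%N)
    (G : pgo_data R d n) (alpha : R) (halpha : 0 <= alpha)
    (X : nat -> 'M[R]_(d, pose_dim d n))
    (hX : gpm_pgo G alpha X \/ gpm_pgo_star G alpha X) :
  nonincreasing_seq (fun k => pgoF G (X k)) /\
  (exists Finf : R, pgoF G (X k) @[k --> \oo] --> Finf) /\
  (posdefmx (Gamma G alpha - Mt G) ->
     frob (X k.+1 - X k) @[k --> \oo] --> (0 : R)) /\
  (posdefmx (Gamma G alpha - Mt G) ->
     rgrad G (X k) @[k --> \oo] --> (0 : 'M[R]_(d, pose_dim d n))) /\
  (0 < alpha -> frob (X k.+1 - X k) @[k --> \oo] --> (0 : R)) /\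
  (0 < alpha ->
     rgrad G (X k) @[k --> \oo] --> (0 : 'M[R]_(d, pose_dim d n))).
Proof.
have [X0 [B stepB]] : pose_mfd (X 0%N) /\
    exists B, forall k, majorized_step G alpha B (X k) (X k.+1).
  case: hX => [[X0 step]|[X0 t0 step]]; split=> //.
    by exists 1%:M => k; exact: gpm_step_majorized.
  exists (t_opt_response G) => k; apply: gpm_star_step_majorized => //.
  by case: k => // k; have [] := step k.
have XM k : pose_mfd (X k).
  by case: k => // k; exact: majorized_step_mfd (stepB k).
have decF : nonincreasing_seq (fun k => pgoF G (X k)).
  apply/nonincreasing_seqP => k.
  exact: majorized_step_nonincr (XM k) (stepB k).
have [Finf cvgF] : exists Finf : R, pgoF G (X k) @[k --> \oo] --> Finf.
  apply/cvg_ex; apply: nonincreasing_is_cvgn => //.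
  by exists 0 => _ [k _ <-]; exact: pgoF_ge0.
have key : (exists2 c, 0 <= c & forall D : 'M[R]_(d, pose_dim d n),
      mxdot D D <= c * mxdot (D *m (Gamma G alpha - Mt G)) D) ->
    frob (X k.+1 - X k) @[k --> \oo] --> (0 : R) /\
    rgrad G (X k) @[k --> \oo] --> (0 : 'M[R]_(d, pose_dim d n)).
  move=> /(@majorized_step_estimate _ _ _ G _ hn halpha B)[C hC].
  have lim0 (u : nat -> R) : (forall k, 0 <= u k) ->
      (forall k, u k <= C * (pgoF G (X k) - pgoF G (X k.+1))) ->
      u k @[k --> \oo] --> (0 : R).
    move=> u0 uC; apply: squeeze_cvgr (cvg_cst (0 : R)) (cvg_decrement0 C cvgF).
    by apply: nearW => k; rewrite u0 uC.
  split.
    apply/frob_cvg0/lim0 => k; first exact: mxdot_ge0.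
    by case: (hC _ _ (XM k) (stepB k)).
  rewrite -(cvg_shiftS (fun k => rgrad G (X k))).
  apply/mx_cvg0/frob_cvg0/lim0 => k; first exact: mxdot_ge0.
  by case: (hC _ _ (XM k) (stepB k)).
have of_posdef := fun h => key (posdefmx_coercive d h).
have of_alpha (a0 : 0 < alpha) := key (Gamma_subMt_coercive G a0).
split; first exact: decF.
split; first by exists Finf.
by split; [move/of_posdef => []|split; [move/of_posdef => []|split=> /of_alpha[]]].
Qed.
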